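(* Assume that $\phi:\mathbb{R}^d\to\mathbb{R}$ is $p$-coercive for some $p>0$, and that $\phi$ has a unique global minimizer $z^*$. If there exists a neighborhood $U$ of $z^*$ such that $\phi$ restricted to $U$ is continuous, then $$\lim_{\delta\to0^+}\frac{\int_{\mathbb{R}^d} z\exp(-\phi(z)/\delta)\,dz}{\int_{\mathbb{R}^d}\exp(-\phi(z)/\delta)\,dz}=z^*.$$
   Context: A function $\phi$ is $p$-coercive if $\phi(z)/\|z\|^p\to\infty$ as $\|z\|\to\infty$, where $\|\cdot\|$ is the Euclidean norm.
   Formalization: Added: φ measurable, and for each w≠z*, liminf of φ(v) as v→w, v≠w, exceeds φ(z* ) (true if φ is lower semicontinuous). Without it the claim fails: φ(w)=min(w²,(w−1)²) on R with φ(1):=1 has unique minimizer 0 but the quotient is always 1/2. *)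

(* Defs.v *)
From HB Require Import structures.
From mathcomp Require Import all_boot all_order all_algebra.
From mathcomp Require Import all_classical all_reals all_analysis.

Set Implicit Arguments.
Unset Strict Implicit.
Unset Printing Implicit Defensive.

Import Order.TTheory GRing.Theory Num.Theory.
Import numFieldNormedType.Exports.

Local Open Scope classical_set_scope.
Local Open Scope ring_scope.

(* Lebesgue measure on R^n (n >= 1, rendered as 'rV[R]_d.+1): the restriction
   to its Caratheodory sets of the outer measure
     A |-> inf { \sum_k vol (B_k) | A included in the union of the boxes B_k }.
   The measurable sets are thus exactly the Lebesgue measurable ones. *)
Section lebesgue_measure_Rn.
Context (R : realType) (d : nat).
Local Notation Rn := 'rV[R]_d.+1.

Definition box (a b : Rn) : set Rn :=
  [set z | forall i, a ord0 i < z ord0 i <= b ord0 i].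

(* A box with a reversed side is empty, whence the truncation at 0. *)
Definition box_volume (a b : Rn) : R :=
  \prod_(i < d.+1) Num.max 0 (b ord0 i - a ord0 i).

Definition box_cover (A : set Rn) : set (nat -> Rn * Rn) :=
  [set B | A `<=` \bigcup_k box (B k).1 (B k).2].

Definition lebesgue_outer (A : set Rn) : \bar R :=
  ereal_inf [set (\sum_(k <oo) (box_volume (B k).1 (B k).2)%:E)%E
            | B in box_cover A].

Let vol (p : Rn * Rn) : \bar R := (box_volume p.1 p.2)%:E.

Let vol_ge0 p : (0 <= vol p)%E.
Proof. by rewrite lee_fin; apply: prodr_ge0 => i _; rewrite le_max lexx. Qed.

Let lebesgue_outer_ge0 A : (0 <= lebesgue_outer A)%E.
Proof.
by apply: le_ereal_inf_tmp => _ [B _ <-]; apply: nneseries_ge0 => k _ _;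
  exact: vol_ge0.
Qed.

Let lebesgue_outer0 : lebesgue_outer set0 = 0%E.
Proof.
apply/eqP; rewrite eq_le lebesgue_outer_ge0 andbT.
apply: ereal_inf_lbound; exists (fun=> (0, 0)); first by move=> z [].
apply: eseries0 => k _ _.
by rewrite /box_volume big_ord_recl /= !mxE subrr maxxx mul0r.
Qed.

Let le_lebesgue_outer : {homo lebesgue_outer : A B / A `<=` B >-> (A <= B)%E}.
Proof.
move=> A B AB; apply/ereal_inf_le_tmp => _ [C BC <-].
by exists C => //; apply: subset_trans AB BC.
Qed.

Let lebesgue_outer_sigma_subadditive : sigma_subadditive lebesgue_outer.
Proof.
move=> A.
have [[i ioo]|] := pselect (exists i, lebesgue_outer (A i) = +oo%E).
  by rewrite (eseries_pinfty _ _ ioo) ?leey// => n _;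
    rewrite -ltNye (lt_le_trans _ (lebesgue_outer_ge0 _)).
rewrite -forallNE => Aoo.
suff add2e (e : {posnum R}) : (lebesgue_outer (\bigcup_n A n) <=
    \sum_(i <oo) lebesgue_outer (A i) + e%:num%:E)%E.
  by apply/lee_addgt0Pr => _/posnumP[].
rewrite (le_trans _ (epsilon_trick _ _ _))//.
pose P n (B : nat -> Rn * Rn) := box_cover (A n) B /\
  (\sum_(k <oo) vol (B k) <=
    lebesgue_outer (A n) + (e%:num / (2 ^ n.+1)%:R)%:E)%E.
have [G PG] : {G : nat -> nat -> Rn * Rn & forall n, P n (G n)}.
  apply: (@choice _ _ P) => n.
  have en1 : 0 < e%:num / (2 ^ n.+1)%:R :> R by [].
  have fn : lebesgue_outer (A n) \is a fin_num.
    by rewrite ge0_fin_numE// ltey; apply/eqP.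
  have [_ [B AB <-] /ltW le] := lb_ereal_inf_adherent en1 fn.
  by exists B.
have muG_ge0 x : (0 <= (vol \o uncurry G) x)%E by exact: vol_ge0.
apply: (@le_trans _ _ (\esum_(i in setT) (vol \o uncurry G) i)%E).
  apply: ereal_inf_lbound => /=.
  have /card_esym/ppcard_eqP[f] := card_nat2.
  exists (uncurry G \o f).
    move=> t [i _ /(PG i).1 [j _ ?]]; exists (f^-1%FUN (i, j)) => //=.
    by rewrite invK ?inE.
  rewrite -(esum_pred_image (vol \o uncurry G) _ xpredT) ?[fun=> _]set_true//.
  by rewrite image_eq.
rewrite (_ : esum _ _ = (\sum_(i <oo) \sum_(j <oo) vol (G i j))%E); last first.
  pose J : nat -> set (nat * nat) := fun i => [set (i, j) | j in setT].
  rewrite (_ : setT = \bigcup_k J k); last first.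
    by rewrite predeqE => -[a b]; split => // _; exists a => //; exists b.
  rewrite esum_bigcupT /=; last 2 first.
    - apply/trivIsetP => i j _ _ ij.
      rewrite predeqE => -[n m] /=; split => //= -[] [_] _ [<-{n} _].
      by move=> [m' _] [] /esym/eqP; rewrite (negbTE ij).
    - by move=> /= [n m]; exact: vol_ge0.
  rewrite -(image_id [set: nat]) -fun_true esum_pred_image//; last first.
    by move=> n _; exact: esum_ge0.
  apply: eq_eseriesr => /= j _.
  rewrite -(esum_pred_image (vol \o uncurry G) (pair j) predT)//=; last first.
    by move=> ? ? _ _; exact: (@can_inj _ _ _ snd).
  by congr esum; rewrite predeqE => -[a b]; split; move=> [i _ <-]; exists i.
apply: lee_nneseries => [n _|n _]; last by have [_] := PG n.
by move=> _; apply: nneseries_ge0 => m _ _; exact: vol_ge0.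
Qed.

HB.instance Definition _ := isOuterMeasure.Build R Rn lebesgue_outer
  lebesgue_outer0 lebesgue_outer_ge0 le_lebesgue_outer
  lebesgue_outer_sigma_subadditive.

Definition lebesgue_Rn : set (caratheodory_type lebesgue_outer) -> \bar R :=
  lebesgue_outer.

HB.instance Definition _ := isMeasure.Build _ _ _ lebesgue_Rn
  (@caratheodory_measure0 R Rn lebesgue_outer)
  (@caratheodory_measure_ge0 R Rn lebesgue_outer)
  (@caratheodory_measure_sigma_additive R Rn lebesgue_outer).

End lebesgue_measure_Rn.
Arguments lebesgue_outer R d A : clear implicits.
Arguments lebesgue_Rn R d : clear implicits.

Section laplace.
Context (R : realType) (d : nat).
Local Notation Rn := 'rV[R]_d.+1.
Implicit Types (phi : Rn -> R) (z : Rn).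

(* The norm `|z| of the library on row vectors is the sup norm. *)
Definition euclidean_norm z : R := Num.sqrt (\sum_(i < d.+1) z ord0 i ^+ 2).

Definition coercive (p : R) phi : Prop :=
  forall M : R, exists r : R, forall z,
    r <= euclidean_norm z -> M <= phi z / euclidean_norm z `^ p.

Definition global_minimizer phi z : Prop := forall w, phi z <= phi w.

Definition unique_global_minimizer phi z : Prop :=
  global_minimizer phi z /\ forall w, global_minimizer phi w -> w = z.

(* No point other than z is a limit of points along which phi tends to its
   minimal value phi z.  Lower semicontinuity and uniqueness of the minimizer
   imply this, but it cannot be dropped: on R, the function
   w |-> min (w ^ 2) ((w - 1) ^ 2), modified to take the value 1 at w = 1, is
   coercive and continuous near its unique minimizer 0, yet all its Gibbs
   means are equal to 1 / 2. *)
Definition liminf_above_min phi z : Prop :=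
  forall w, w <> z -> ((phi z)%:E < limf_einf (EFin \o phi) w^')%E.

Definition gibbs_weight phi (delta : R) z : R := expR (- phi z / delta).

Definition gibbs_mass phi (delta : R) : R :=
  \int[lebesgue_Rn R d]_z gibbs_weight phi delta z.

(* The vector-valued integral is taken coordinatewise. *)
Definition gibbs_moment phi (delta : R) : Rn :=
  \row_(i < d.+1) \int[lebesgue_Rn R d]_z (z ord0 i * gibbs_weight phi delta z).

Definition gibbs_mean phi (delta : R) : Rn :=
  (gibbs_mass phi delta)^-1 *: gibbs_moment phi delta.

(* Both integrals in the quotient exist and the denominator is nonzero. *)
Definition gibbs_mean_defined phi (delta : R) : Prop :=
  [/\ (lebesgue_Rn R d).-integrable setT (EFin \o gibbs_weight phi delta),
      forall i : 'I_d.+1, (lebesgue_Rn R d).-integrable setT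
        (fun z : Rn => (z ord0 i * gibbs_weight phi delta z)%:E) &
      0 < gibbs_mass phi delta].

Definition lebesgue_measurable phi : Prop :=
  measurable_fun [set: caratheodory_type (lebesgue_outer R d)] phi.

End laplace.

(* Main.v *)
(* Write m for the minimum of phi.  By coercivity and compactness,
   [phi >= m + eta] outside the e-ball around zstar, hence for [delta <= 1]
     exp (- phi / delta) <= exp (- (m + eta) (1 / delta - 1)) exp (- phi)
   there, whereas continuity at zstar gives [phi <= m + eta / 2] on a small
   cube, so that the mass is at least a multiple of
   [exp (- (m + eta / 2) / delta)].  The ball contributes at most e to the
   deviation of the Gibbs mean from zstar, and its complement at most a
   multiple of [exp (- eta / (2 delta)) <= 2 delta / eta]. *)
Require Import Defs.
From mathcomp Require Import all_boot all_order all_algebra.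
From mathcomp Require Import all_classical all_reals all_analysis measurable_realfun.
From mathcomp Require Import ring lra.
Import Order.TTheory GRing.Theory Num.Theory.
Import numFieldNormedType.Exports.
Local Open Scope classical_set_scope.
Local Open Scope ring_scope.

(** * Volume of a box against the volumes of a countable cover *)

Lemma lebesgue_measure_itvoc {R : realType} (x y : R) :
  lebesgue_measure (`]x, y]%classic : set R) = (Num.max 0 (y - x))%:E.
Proof.
rewrite lebesgue_measure_itv /= lte_fin; case: ltP => xy.
  by rewrite -EFinB max_r// subr_ge0 ltW.
by rewrite max_l// subr_le0.
Qed.

(** Corners are sequences rather than row vectors, so that an induction on the dimension [n] can
    keep the same [a] and [b]. *)
Definition volume {R : realType} (n : nat) (a b : nat -> R) : R :=
  \prod_(i < n) Num.max 0 (b i - a i).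

Lemma volume_ge0 {R : realType} n (a b : nat -> R) : 0 <= volume n a b.
Proof. by apply: prodr_ge0 => i _; rewrite le_max lexx. Qed.

(* Integrate the inequality for the slices in the last coordinate against
   one-dimensional Lebesgue measure; s selects the boxes that meet the slice. *)
Lemma volume_le_cover {R : realType} (n : nat) (a b : nat -> R)
    (s : pred nat) (A B : nat -> nat -> R) :
  (forall z : nat -> R, (forall i, (i < n)%N -> a i < z i <= b i) ->
    exists2 k, s k & forall i, (i < n)%N -> A k i < z i <= B k i) ->
  ((volume n a b)%:E <=
   \sum_(0 <= k <oo) ((s k)%:R * volume n (A k) (B k))%:E)%E.
Proof.
elim: n => [|n IH] in s * => cover.
  (* In dimension 0 every volume is the empty product 1, and the cover hypothesis yields one
     selected index, so the sum is at least 1. *)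
  have [//|k sk _] := cover (fun=> 0).
  have V0 u v : volume 0 u v = 1 :> R by rewrite /volume big_ord0.
  rewrite V0 (le_trans _ (nneseries_lim_ge k.+1 _))//.
    rewrite big_nat_recr//= sk V0 mulr1 leeDr// sume_ge0// => i _.
    by rewrite V0 lee_fin mulr1.
  by move=> i _; rewrite V0 lee_fin mulr1.
have VS u v : volume n.+1 u v = volume n u v * Num.max 0 (v n - u n) :> R.
  by rewrite /volume big_ord_recr.
pose I : set R := `]a n, b n]%classic.
pose J k : set R := `]A k n, B k n]%classic.
have mI : measurable (I : set (measurableTypeR R)) by exact: measurable_itv.
have mJ k : measurable (J k : set (measurableTypeR R)) by exact: measurable_itv.
pose V k : R := (s k)%:R * volume n (A k) (B k).
have V0 k : 0 <= V k by rewrite mulr_ge0// volume_ge0.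
have VJ0 k t : (0 <= (V k)%:E * (\1_(J k) t)%:E)%E.
  by rewrite -EFinM lee_fin mulr_ge0.
have mVJ k : measurable_fun (I : set (measurableTypeR R))
    (fun t => ((V k)%:E * (\1_(J k) t)%:E)%E : \bar R).
  by apply/measurable_EFinP; apply: measurable_funM.
rewrite VS EFinM -lebesgue_measure_itvoc -/I.
rewrite -[X in (X <= _)%E]integral_cst//.
apply: (@le_trans _ _
  (\int[lebesgue_measure]_(t in I) \sum_(0 <= k <oo) ((V k)%:E * (\1_(J k) t)%:E))%E).
  apply: ge0_le_integral => //=.
  - by move=> t _; rewrite lee_fin; exact: volume_ge0.
  - by apply: ge0_emeasurable_sum => // k _; apply: mVJ.
  - move=> t It.
    (* On the slice at height [t], only the boxes whose last side contains [t] remain; a point of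
       the slice becomes a point of the full box by appending [t]. *)
    apply: (le_trans (IH (fun k => s k && (t \in J k)) _)).
      move=> z zab.
      have [i|k sk zAB] := cover (fun i => if i == n then t else z i).
        rewrite ltnS leq_eqVlt; case: eqVneq => [->_|_ /=]; last exact: zab.
        by move: It; rewrite /I/= in_itv.
      exists k.
        rewrite sk/= inE /J/= in_itv/=.
        by have := zAB n (ltnSn n); rewrite eqxx.
      by move=> i ilt; have := zAB i (ltnW ilt); rewrite (ltn_eqF ilt).
    apply: lee_nneseries => k _; first by rewrite lee_fin mulr_ge0// volume_ge0.
    by rewrite -EFinM lee_fin /V indicE -mulnb natrM mulrAC.
rewrite integral_nneseries//.
apply: lee_nneseries => [k _ _|k _]; first by apply: integral_ge0 => t _; exact: VJ0.
rewrite ge0_integralZl_EFin//; last first.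
  by apply/measurable_EFinP; apply: measurable_indic.
rewrite integral_indic// VS mulrA [X in (_ <= X)%E]EFinM -lebesgue_measure_itvoc.
by rewrite lee_pmul// ?lee_fin ?V0// le_measure// inE//; exact: measurableI.
Qed.

(** * Measurability and measure of boxes *)

Section lebesgue_Rn_boxes.
Context {R : realType} {d : nat}.
Local Notation Rn := 'rV[R]_d.+1.
Implicit Types (a b z : Rn) (X : set Rn).

Lemma box_volume_ge0 a b : 0 <= box_volume a b.
Proof. by apply: prodr_ge0 => i _; rewrite le_max lexx. Qed.

Lemma box_volume_volume a b :
  box_volume a b = volume d.+1 (fun i => a ord0 (inord i)) (fun i => b ord0 (inord i)).
Proof. by rewrite /volume; apply: eq_bigr => i _; rewrite inord_val. Qed.

Lemma lebesgue_outer_box a b : lebesgue_outer R d (box a b) = (box_volume a b)%:E.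
Proof.
apply/eqP; rewrite eq_le; apply/andP; split.
  apply: ereal_inf_lbound.
  exists (fun k : nat => (if k == 0%N then (a, b) else (0, 0)) : Rn * Rn).
    by move=> z zab; exists 0.
  rewrite (nneseriesD1 (n := 0))//= => [|k _]; last by rewrite lee_fin box_volume_ge0.
  rewrite eseries0 ?adde0// => -[//|k] _ _.
  by rewrite /box_volume big_ord_recl /= !mxE subrr maxxx mul0r.
apply: le_ereal_inf_tmp => _ [B cover <-].
rewrite box_volume_volume.
apply: (le_trans (volume_le_cover _ _ _ predT (fun k i => (B k).1 ord0 (inord i))
  (fun k i => (B k).2 ord0 (inord i)) _)) => [z zab|].
  have [i|k _ Bk] := cover (\row_i z i).
    by have := zab i (ltn_ord i); rewrite mxE inord_val.
  by exists k => // i id; have := Bk (inord i); rewrite mxE inordK.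
apply: lee_nneseries => [k _ _|k _]; first by rewrite lee_fin mul1r volume_ge0.
by rewrite mul1r -box_volume_volume.
Qed.

(** The hyperplane at [c] cuts each box of a cover of [X] into two half-open boxes without
    increasing the total volume, so the cover splits into covers of the two pieces of [X]. *)
Lemma caratheodory_halfspace (i : 'I_d.+1) (c : R) :
  measurable ([set z : Rn | c < z ord0 i] : set (caratheodory_type (lebesgue_outer R d))).
Proof.
apply: le_caratheodory_measurable => X.
apply: le_ereal_inf_tmp => _ [B cover <-].
pose upd (z : Rn) (v : R) : Rn := \row_j (if j == i then v else z ord0 j).
(* [B1] keeps the part above [c], [B2] the part at or below [c]. If the hyperplane misses the box,
   one of them is empty and its volume is truncated to 0. *)
pose B1 k := (upd (B k).1 (Num.max ((B k).1 ord0 i) c), (B k).2).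
pose B2 k := ((B k).1, upd (B k).2 (Num.min ((B k).2 ord0 i) c)).
have vol0 (p : Rn * Rn) : (0 <= (box_volume p.1 p.2)%:E)%E by rewrite lee_fin box_volume_ge0.
apply: (@le_trans _ _ (\sum_(k <oo) (box_volume (B1 k).1 (B1 k).2)%:E +
    \sum_(k <oo) (box_volume (B2 k).1 (B2 k).2)%:E)%E).
  apply: leeD; apply: ereal_inf_lbound.
  - exists B1 => // z [/cover[k _ Bk] /= cz]; exists k => // j.
    rewrite mxE; case: eqP => [->|_]; last exact: Bk.
    by rewrite gt_max cz andbT; exact: Bk.
  - exists B2 => // z [/cover[k _ Bk] /= /negP]; rewrite -leNgt => zc; exists k => // j.
    rewrite mxE; case: eqP => [->|_]; last exact: Bk.
    by rewrite le_min zc andbT; exact: Bk.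
rewrite -nneseriesD//.
apply: lee_nneseries => [k _ _|k _]; first by rewrite adde_ge0// vol0.
have volE u v : box_volume u v = Num.max 0 (v ord0 i - u ord0 i) *
    \prod_(j < d.+1 | j != i) Num.max 0 (v ord0 j - u ord0 j).
  by rewrite /box_volume (bigD1 i).
pose P := \prod_(j < d.+1 | j != i) Num.max 0 ((B k).2 ord0 j - (B k).1 ord0 j).
have P1 : \prod_(j < d.+1 | j != i) Num.max 0 ((B1 k).2 ord0 j - (B1 k).1 ord0 j) = P.
  by apply: eq_bigr => j /negbTE ji; rewrite mxE ji.
have P2 : \prod_(j < d.+1 | j != i) Num.max 0 ((B2 k).2 ord0 j - (B2 k).1 ord0 j) = P.
  by apply: eq_bigr => j /negbTE ji; rewrite mxE ji.
rewrite -EFinD lee_fin !volE P1 P2 -mulrDl ler_wpM2r//.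
  by apply: prodr_ge0 => j _; rewrite le_max lexx.
rewrite !mxE eqxx.
move: ((B k).1 ord0 i) ((B k).2 ord0 i) => u v.
by rewrite !maxEle minEle; do !case: ifPn; rewrite -?ltNge; lra.
Qed.

Lemma measurable_coord (i : 'I_d.+1) :
  measurable_fun [set: caratheodory_type (lebesgue_outer R d)] (fun z : Rn => z ord0 i).
Proof.
apply: (measurability _ (RGenOInfty.measurableE R)) => _ [_ [c ->] <-].
rewrite setTI.
have -> : (fun z : Rn => z ord0 i) @^-1` `]c, +oo[%classic = [set z : Rn | c < z ord0 i].
  by apply/seteqP; split => z /=; rewrite in_itv/= andbT.
exact: caratheodory_halfspace.
Qed.

Lemma measurable_box a b : measurable (box a b : set (caratheodory_type (lebesgue_outer R d))).
Proof.
have -> : box a b = \bigcap_(i in [set: 'I_d.+1])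
    (fun z : Rn => z ord0 i) @^-1` `]a ord0 i, b ord0 i]%classic.
  by apply/seteqP; split => z zab i /=; [move=> _|]; have := zab i; rewrite /= in_itv/=; apply.
apply: fin_bigcap_measurable => [|i _]; first exact: finite_finset.
by rewrite -[X in measurable X]setTI; exact: measurable_coord.
Qed.

(** Up to its faces, the sup-norm ball of radius [r]. *)
Definition cube z (r : R) : set Rn := box (z - const_mx r) (z + const_mx r).

Lemma lebesgue_Rn_cube z (r : R) : 0 <= r ->
  lebesgue_Rn R d (cube z r) = ((2 * r) ^+ d.+1)%:E.
Proof.
move=> r0; rewrite -[LHS]/(lebesgue_outer R d (cube z r)) lebesgue_outer_box.
congr EFin; rewrite /box_volume -[in RHS](card_ord d.+1) -prodr_const.
apply: eq_bigr => i _; rewrite !mxE max_r; first by lra.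
by rewrite subr_ge0; lra.
Qed.

End lebesgue_Rn_boxes.

(** * Integrability from polynomial decay *)

Section decay.
Context {R : realType} {d : nat}.
Local Notation Rn := 'rV[R]_d.+1.
Local Notation mu := (lebesgue_Rn R d).

Lemma coord_le_norm (z : Rn) i : `|z ord0 i| <= `|z|.
Proof.
rewrite [leRHS]/Num.norm/= mx_normrE.
exact: (le_bigmax _ (fun ij => `|z ij.1 ij.2|) (ord0, i)).
Qed.

Lemma norm_le_coord (z : Rn) (e : R) : 0 <= e ->
  (forall i, `|z ord0 i| <= e) -> `|z| <= e.
Proof.
move=> e0 ze; rewrite [leLHS]/Num.norm/= mx_normrE.
by apply: bigmax_le => // -[i j] _ /=; rewrite ord1.
Qed.

Let Q k : set Rn := cube 0 (2 ^+ k).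

Let Q_norm k (z : Rn) : ~ Q k z -> 2 ^+ k <= `|z|.
Proof.
apply: contra_notP => /negP; rewrite -ltNge => zk i; rewrite !mxE sub0r add0r.
have := le_lt_trans (coord_le_norm z i) zk.
by rewrite ltr_norml => /andP[-> /ltW ->].
Qed.

(** The exponent [d.+2] exceeds the dimension by one, which makes the contributions of dyadic shells
    decay geometrically. *)
Lemma integrable_decay (f : Rn -> R) (C : R) :
  lebesgue_measurable f ->
  (forall z, `|f z| <= C) -> (forall z, `|f z| * `|z| ^+ d.+2 <= C) ->
  mu.-integrable setT (EFin \o f).
Proof.
move=> mf fC fzC.
have C0 : 0 <= C by exact: le_trans (fC 0).
(* [f] is dominated by the sum of the [c k] times the indicators of the dyadic
   cubes [Q k], whose masses are summable. *)
pose c k : R := C * 2 ^+ d.+2 / (2 ^+ k) ^+ d.+2.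
have c0 k : 0 <= c k.
  by apply: divr_ge0; [apply: mulr_ge0 => //; apply: exprn_ge0 | do 2!apply: exprn_ge0].
have fc z : exists2 k, Q k z & `|f z| <= c k.
  have exQ : exists k, `[< Q k z >].
    have [k zk] : exists k, `|z| < 2 ^+ k.
      exists (Num.bound `|z|); rewrite (lt_trans (archi_boundP _))//.
      by rewrite -natrX ltr_nat ltn_expl.
    by exists k; apply/asboolP; apply: contrapT => /Q_norm; rewrite leNgt zk.
  (* Take the least cube containing [z]. If its index is [k.+1], then [z] is outside [Q k] and has
     norm at least [2 ^+ k]; the factor [2 ^+ d.+2] in [c] absorbs this shift of index. *)
  case: (ex_minnP exQ) => k /asboolP Qk kmin; exists k => //.
  case: k Qk kmin => [_ _|k _ kmin].
    rewrite (le_trans (fC z))// /c expr0 expr1n divr1 ler_peMr//.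
    by rewrite exprn_ege1// ler1n.
  have zk : 2 ^+ k <= `|z|.
    by apply: Q_norm => /asboolP /kmin; rewrite ltnn.
  rewrite /c ler_pdivlMr ?exprn_gt0// [2 ^+ k.+1]exprS exprMn mulrCA [C * _]mulrC.
  rewrite ler_pM2l ?exprn_gt0// (le_trans _ (fzC z))//.
  by rewrite ler_wpM2l// lerXn2r// nnegrE.
apply/integrableP; split; first exact/measurable_EFinP.
pose g k z : \bar R := ((c k)%:E * (\1_(Q k) z)%:E)%E.
have g0 k z : (0 <= g k z)%E by rewrite /g -EFinM lee_fin mulr_ge0.
have mQ k : measurable (Q k : set (caratheodory_type (lebesgue_outer R d))).
  exact: measurable_box.
have mg k : measurable_fun [set: caratheodory_type (lebesgue_outer R d)] (g k).
  by apply/measurable_EFinP; apply: measurable_funM => //; apply: measurable_indic.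
apply: (@le_lt_trans _ _ (\int[mu]_z \sum_(k <oo) g k z)%E).
  apply: ge0_le_integral => //=.
  - by apply/measurable_EFinP; apply: measurableT_comp.
  - by apply: ge0_emeasurable_sum.
  - move=> z _; have [k Qk fk] := fc z.
    rewrite (nneseriesD1 (n := k))// -[leLHS]adde0 leeD ?nneseries_ge0//.
    by rewrite /g indicE mem_set// mule1 lee_fin.
rewrite integral_nneseries//.
(* The product of [c k] and the measure of [Q k] equals [K / 2 ^ k.+1], and these terms sum to
   [K]. *)
pose K : R := C * 2 ^+ d.+2 * 2 ^+ d.+2.
apply: (@le_lt_trans _ _ K%:E); last exact: ltry.
apply: le_trans (epsilon_trick0 xpredT _); last first.
  by do 2!apply: mulr_ge0 => //; apply: exprn_ge0.
apply: lee_nneseries => [k _ _|k _]; first exact: integral_ge0.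
rewrite ge0_integralZl_EFin//; last first.
  by apply/measurable_EFinP; apply: measurable_indic.
rewrite integral_indic// setIT [X in (_ * X)%E](lebesgue_Rn_cube 0 _ (exprn_ge0 k (ler0n _ 2)))
  -EFinM lee_fin /c /K.
rewrite natrX exprMn [2 ^+ k.+1]exprS.
have : 0 < 2 ^+ k :> R by rewrite exprn_gt0.
move: (2 ^+ k) => x x0.
rewrite [x ^+ d.+2]exprS [2 ^+ d.+2]exprS.
have : 0 < x ^+ d.+1 by rewrite exprn_gt0.
move: (x ^+ d.+1) (2 ^+ d.+1) => y t y0.
rewrite le_eqVlt; apply/orP; left; apply/eqP; field.
by rewrite !gt_eqF.
Qed.

End decay.

(** * Integrability of the Gibbs weights under coercivity *)

Section weight.
Context {R : realType} {d : nat}.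
Local Notation Rn := 'rV[R]_d.+1.
Local Notation mu := (lebesgue_Rn R d).
Implicit Types (phi : Rn -> R).

Lemma powR_expR_bounded (p delta : R) n : 0 < p -> 0 < delta ->
  exists K, forall t, 1 <= t -> t ^+ n * expR (- (t `^ p) / delta) <= K.
Proof.
move=> p0 delta0; pose m := Num.bound (n%:R / p).
exists (delta ^+ m.+1 * (m.+1)`!%:R) => t t1.
have t0 : 0 <= t by rewrite (le_trans _ t1).
set s := t `^ p.
have s0 : 0 <= s by exact: powR_ge0.
have tns : t ^+ n <= s ^+ m.+1.
  rewrite -!powR_mulrn// -powRrM ler_powR//.
  rewrite mulrC -ler_pdivrMr// (le_trans (ltW (archi_boundP _)))//.
    by rewrite divr_ge0// ltW.
  by rewrite ler_nat leqnSn.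
have sE : s ^+ m.+1 <= delta ^+ m.+1 * (m.+1)`!%:R * expR (s / delta).
  have := @expR_ge1Dxn R (s / delta) m (divr_ge0 s0 (ltW delta0)).
  move/(le_trans (ler_wpDl ler01 (lexx _))).
  rewrite expr_div_n ler_pdivrMr ?ltr0n ?fact_gt0// ler_pdivrMr ?exprn_gt0//.
  by move=> /le_trans; apply; rewrite mulrC [X in _ * X]mulrC mulrA.
rewrite mulNr expRN ler_pdivrMr ?expR_gt0//.
exact: le_trans sE.
Qed.

Lemma norm_le_euclidean (z : Rn) : `|z| <= euclidean_norm z.
Proof.
apply: norm_le_coord => [|i]; first exact: sqrtr_ge0.
rewrite -sqrtr_sqr ler_sqrt; last by apply: sumr_ge0 => j _; exact: sqr_ge0.
by rewrite (bigD1 i)//= lerDl; apply: sumr_ge0 => j _; exact: sqr_ge0.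
Qed.

(** Coercivity is taken at [M = 1]. The sup norm is at most the Euclidean one, so both the threshold
    and the lower bound pass to the sup norm. *)
Lemma coercive_ge_powR (p : R) phi : 0 < p -> coercive p phi ->
  exists2 r, 1 <= r & forall z, r <= `|z| -> `|z| `^ p <= phi z.
Proof.
move=> p0 /(_ 1)[r hr]; exists (Num.max 1 r); first by rewrite le_max lexx.
move=> z; rewrite ge_max => /andP[z1 rz].
have zN := norm_le_euclidean z.
have := hr z (le_trans rz zN).
have N0 : 0 < euclidean_norm z by rewrite (lt_le_trans _ (le_trans z1 zN)).
rewrite ler_pdivlMr ?powR_gt0// mul1r; apply: le_trans.
by rewrite ge0_ler_powR// ?nnegrE// ltW.
Qed.

Lemma gibbs_weight_gt0 phi delta z : 0 < gibbs_weight phi delta z.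
Proof. exact: expR_gt0. Qed.

(** Beyond radius [r] coercivity reduces the claim to [powR_expR_bounded]; within it, the minimum of
    [phi] bounds the weight. *)
Lemma gibbs_weight_decay (p : R) phi zstar delta n : 0 < p -> 0 < delta ->
  coercive p phi -> global_minimizer phi zstar ->
  exists C, forall z, `|z| ^+ n * gibbs_weight phi delta z <= C.
Proof.
move=> p0 delta0 /(coercive_ge_powR _ _ p0)[r r1 hr] hmin.
have [K hK] := powR_expR_bounded p delta n p0 delta0.
exists (Num.max K (r ^+ n * expR (- phi zstar / delta))) => z.
have [rz|zr] := leP r `|z|; rewrite le_max; apply/orP; [left|right].
  apply: le_trans (hK _ (le_trans r1 rz)).
  rewrite ler_wpM2l ?exprn_ge0// ler_expR ler_pM2r ?invr_gt0// lerN2.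
  exact: hr.
rewrite ler_pM ?exprn_ge0 ?expR_ge0//.
  by apply: lerXn2r; rewrite ?nnegrE ?(ltW zr) // (le_trans ler01).
by rewrite ler_expR ler_pM2r ?invr_gt0// lerN2.
Qed.

Lemma measurable_gibbs_weight phi delta : lebesgue_measurable phi ->
  lebesgue_measurable (gibbs_weight phi delta).
Proof.
move=> mphi; apply: measurableT_comp => //.
by apply: measurable_funM => //; exact: measurableT_comp.
Qed.

(** Serves the denominator with [n = 0] and the coordinates of the numerator with [n = 1]. *)
Lemma integrable_gibbs_weight (p : R) phi zstar delta n (f : Rn -> R) :
  0 < p -> 0 < delta -> coercive p phi -> global_minimizer phi zstar ->
  lebesgue_measurable phi -> lebesgue_measurable f ->
  (forall z, `|f z| <= `|z| ^+ n) ->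
  mu.-integrable setT (EFin \o (fun z => f z * gibbs_weight phi delta z)).
Proof.
move=> p0 delta0 hc hmin mphi mf fn.
have [C1 hC1] := gibbs_weight_decay p phi zstar delta n p0 delta0 hc hmin.
have [C2 hC2] := gibbs_weight_decay p phi zstar delta (n + d.+2) p0 delta0 hc hmin.
have fw z : `|f z * gibbs_weight phi delta z| <= `|z| ^+ n * gibbs_weight phi delta z.
  have w0 := ltW (gibbs_weight_gt0 phi delta z).
  by rewrite normrM (ger0_norm w0) ler_wpM2r.
apply: (integrable_decay _ (Num.max C1 C2)) => [|z|z].
- by apply: measurable_funM => //; exact: measurable_gibbs_weight.
- by rewrite le_max (le_trans (fw z)).
- rewrite le_max; apply/orP; right; apply: le_trans (hC2 z).
  by rewrite exprD mulrAC ler_wpM2r ?exprn_ge0.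
Qed.

End weight.

(** * Gap between the minimum and the values away from the minimizer *)

Section gap.
Context {R : realType} {d : nat}.
Local Notation Rn := 'rV[R]_d.+1.
Implicit Types (phi : Rn -> R).

(** The lower limit controls a punctured neighbourhood of [w]; at [w] itself, uniqueness of the
    minimizer gives the strict inequality. *)
Lemma liminf_above_min_near phi zstar w : unique_global_minimizer phi zstar ->
  liminf_above_min phi zstar -> w <> zstar ->
  exists2 c, phi zstar < c & \forall z \near w, c <= phi z.
Proof.
move=> [hmin huniq] hlim wz.
move: (hlim w wz); rewrite limf_einfE => /ereal_sup_gt[_ [V wV <-] mV].
have [c mc cV] : exists2 c, phi zstar < c & forall z, V z -> c <= phi z.
  have infV z : V z -> (ereal_inf [set (EFin \o phi) x | x in V] <= (phi z)%:E)%E.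
    by move=> Vz; apply: ereal_inf_lbound; exists z.
  move: mV infV; case: (ereal_inf _) => [c| |] //= mc infV.
    by exists c => // z /infV.
  (* Case of infimum [+oo]: [infV] is contradictory at every point of [V], so any [c] above the
     minimum works. *)
  by exists (phi zstar + 1) => [|z /infV//]; rewrite ltrDl.
have mw : phi zstar < phi w.
  rewrite ltNge; apply/negP => wm; apply: wz; apply: huniq => v.
  exact: le_trans wm (hmin v).
exists (Num.min c (phi w)); first by rewrite lt_min mc.
move: wV; rewrite /dnbhs /within /=; apply: filterS => z /= Vz.
rewrite ge_min; have [->|/eqP zw] := eqVneq z w; first by rewrite lexx orbT.
by rewrite cV//; apply: Vz; apply/eqP.
Qed.

Lemma gap_away_from_minimizer (p : R) phi zstar e : 0 < p -> coercive p phi ->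
  unique_global_minimizer phi zstar -> liminf_above_min phi zstar -> 0 < e ->
  exists2 eta, 0 < eta & forall z, e <= `|z - zstar| -> phi zstar + eta <= phi z.
Proof.
move=> p0 /(coercive_ge_powR _ _ p0)[r r1 hr] hmin hlim e0.
(* Chosen so that the [p]-th power of a norm at least [rho] exceeds the minimum by 1 or more. *)
pose rho := Num.max r ((`|phi zstar| + 1) `^ p^-1).
have far z : rho <= `|z| -> phi zstar + 1 <= phi z.
  rewrite ge_max => /andP[rz mz]; apply: le_trans (hr _ rz).
  apply: (@le_trans _ _ (`|phi zstar| + 1)); first by rewrite lerD2r ler_norm.
  have -> : `|phi zstar| + 1 = ((`|phi zstar| + 1) `^ p^-1) `^ p.
    by rewrite -powRrM mulVf ?gt_eqF// powRr1// addr_ge0.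
  by rewrite ge0_ler_powR// ?nnegrE ?powR_ge0// ltW.
pose K : set Rn := [set z | `|z| <= rho /\ e <= `|z - zstar|].
have cK : compact K.
  apply: bounded_closed_compact.
    exists rho; split; first exact: num_real.
    by move=> M rM z [zr _] /=; rewrite (le_trans zr)// ltW.
  apply: closedI.
    apply: (@closed_comp _ _ (fun z : Rn => `|z|) [set x | x <= rho]).
      by move=> z _; exact: norm_continuous.
    exact: closed_le.
  apply: (@closed_comp _ _ (fun z : Rn => `|z - zstar|) [set x | e <= x]).
    move=> z _; apply: continuous_comp; last exact: norm_continuous.
    by apply: continuousB; [exact: cvg_id|exact: cst_continuous].
  exact: closed_ge.
(* Each point of [K] has a neighbourhood on which every small enough [eta] is a valid gap;
   compactness makes the threshold uniform over [K]. *)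
have /compact_near_coveringP/(_ R (0^'+) (fun eta z => phi zstar + eta <= phi z)) := cK.
move=> /(_ _)[].
  move=> w [_ ew].
  have [|c mc wc] := liminf_above_min_near phi zstar w hmin hlim.
    by move=> wz; move: ew; rewrite wz subrr normr0 leNgt e0.
  exists ([set z | c <= phi z], [set eta | eta < c - phi zstar]); first split => //=.
    by apply: nbhs_right_lt; rewrite subr_gt0.
  move=> [z eta] /= [cz etac]; apply: le_trans cz.
  by rewrite -lerBrDl ltW.
move=> eta0 /= eta00 hK.
(* The 1 suits the far region; [eta0 / 2] lies strictly inside the ball of radius [eta0] on which
   the gap over [K] holds. *)
pose eta := Num.min 1 (eta0 / 2).
have eta_gt0 : 0 < eta by rewrite lt_min ltr01 divr_gt0.
exists eta => // z ez.
have [/far zr|zr] := leP rho `|z|.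
  by apply: le_trans zr; rewrite lerD2l ge_min lexx.
apply: (hK eta) => //=; last by split => //; exact: ltW.
rewrite sub0r normrN gtr0_norm// gt_min; apply/orP; right.
by rewrite ltr_pdivrMr// ltr_pMr// ltr1n.
Qed.

End gap.

(** * Quantitative concentration of the Gibbs mean *)

Section gibbs_mean.
Context {R : realType} {d : nat}.
Local Notation Rn := 'rV[R]_d.+1.
Local Notation mu := (lebesgue_Rn R d).
Implicit Types (phi : Rn -> R) (zstar z : Rn) (eta r c e delta : R).

Lemma continuous_le_on_cube phi zstar eta : 0 < eta ->
  (exists2 U : set Rn, nbhs zstar U & {within U, continuous phi}) ->
  exists2 r, 0 < r &
    forall z, cube zstar r z -> phi z <= phi zstar + eta.
Proof.
move=> eta0 [U Uz /subspace_continuousP/(_ zstar (nbhs_singleton Uz))].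
move=> /cvgrPdist_le/(_ _ eta0); rewrite near_withinE => near_phi.
have : \forall z \near zstar, `|phi zstar - phi z| <= eta.
  by near=> z; apply: (near near_phi z) => //; near: z.
(* Halving the radius puts the cube, with its closed faces, inside the open ball. *)
move=> /nbhs_ballP[e /= e0 he]; exists (e / 2) => [|z zbox]; first by rewrite divr_gt0.
have : `|phi zstar - phi z| <= eta.
  apply: he; rewrite -ball_normE /ball_/=; apply: (@le_lt_trans _ _ (e / 2)); last first.
    by rewrite ltr_pdivrMr// ltr_pMr// ltr1n.
  apply: norm_le_coord => [|i]; first by rewrite divr_ge0// ltW.
  have := zbox i; rewrite !mxE => /andP[lo hi].
  by rewrite ler_norml; apply/andP; split; lra.
by rewrite distrC ler_norml => /andP[_]; lra.
Unshelve. all: by end_near. Qed.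

Lemma gibbs_mass_ge phi zstar delta c r : 0 < r -> 0 < delta ->
  (forall z, cube zstar r z -> phi z <= c) ->
  mu.-integrable setT (EFin \o gibbs_weight phi delta) ->
  expR (- c / delta) * (2 * r) ^+ d.+1 <= gibbs_mass phi delta.
Proof.
move=> r0 delta0; set B := cube _ _ => hc iw.
have mB : measurable (B : set (caratheodory_type (lebesgue_outer R d))).
  exact: measurable_box.
have volB := lebesgue_Rn_cube zstar r (ltW r0).
rewrite -lee_fin [leRHS]fineK; last exact: integrable_fin_num.
rewrite EFinM -volB -[X in (_ * mu X)%E]setIT -integral_indic//.
rewrite -ge0_integralZl_EFin ?expR_ge0//; last first.
  by apply/measurable_EFinP; apply: measurable_indic.
apply: ge0_le_integral => //=.
- apply/measurable_EFinP; apply: measurable_funM => //; exact: measurable_indic.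
- by case/integrableP: iw.
move=> z _; rewrite -EFinM lee_fin indicE; case: (boolP (z \in B)) => [|_].
  rewrite inE mulr1 => /hc zc.
  by rewrite ler_expR ler_pM2r ?invr_gt0// lerN2.
by rewrite mulr0 expR_ge0.
Qed.

(** Split [1 / delta] as [1 + (1 / delta - 1)] with a nonnegative second term: one factor is the
    weight at temperature 1, whose integrals do not depend on [delta]. *)
Lemma gibbs_weight_le phi delta c z : 0 < delta -> delta <= 1 -> c <= phi z ->
  gibbs_weight phi delta z <= expR (- c * (delta^-1 - 1)) * gibbs_weight phi 1 z.
Proof.
move=> delta0 delta1 cz; rewrite /gibbs_weight -expRD ler_expR divr1.
have d1 : 0 <= delta^-1 - 1 by rewrite subr_ge0 invf_ge1.
by have := ler_wpM2r d1 cz; nra.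
Qed.

Lemma gibbs_mean_coord_bound phi (p : R) zstar e i : 0 < p -> coercive p phi ->
  unique_global_minimizer phi zstar -> liminf_above_min phi zstar ->
  (exists2 U : set Rn, nbhs zstar U & {within U, continuous phi}) ->
  (forall delta, 0 < delta -> gibbs_mean_defined phi delta) -> 0 < e ->
  exists C, forall delta, 0 < delta -> delta <= 1 ->
    `|zstar ord0 i - gibbs_mean phi delta ord0 i| <= e + C * delta.
Proof.
move=> p0 hc hmin hlim hcont hdef e0.
have [eta eta0 hgap] := gap_away_from_minimizer p phi zstar e p0 hc hmin hlim e0.
have [r r0 hr] := continuous_le_on_cube phi zstar (eta / 2) (divr_gt0 eta0 (ltr0Sn _ 1)) hcont.
pose m := phi zstar.
pose f delta (z : Rn) := (z ord0 i - zstar ord0 i) * gibbs_weight phi delta z.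
have fE delta : EFin \o f delta = ((fun z => (z ord0 i * gibbs_weight phi delta z)%:E) \-
    (fun z => (zstar ord0 i)%:E * (EFin \o gibbs_weight phi delta) z))%E.
  by apply/funext => z /=; rewrite /f mulrBl EFinB.
have iw delta : 0 < delta -> mu.-integrable setT (EFin \o gibbs_weight phi delta).
  by move=> /hdef[].
have izw delta : 0 < delta -> mu.-integrable setT
    (EFin \o (fun z : Rn => z ord0 i * gibbs_weight phi delta z)).
  by move=> delta0; have [_ h _] := hdef _ delta0; exact: h.
have icw delta : 0 < delta -> mu.-integrable setT
    (EFin \o (fun z : Rn => zstar ord0 i * gibbs_weight phi delta z)).
  by move=> /iw; exact: integrableZl.
have if_ delta : 0 < delta -> mu.-integrable setT (EFin \o f delta).
  move=> delta0; rewrite fE; apply: integrableB => //; first exact: izw.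
  exact: icw.
pose K := \int[mu]_z `|f 1 z|.
have K0 : 0 <= K by exact: Rintegral_ge0.
pose v := (2 * r) ^+ d.+1.
have v0 : 0 < v by rewrite exprn_gt0// mulr_gt0.
(* Comes from dividing the tail [A * K] by the lower bound [massv] on the mass; [2 / eta] is left by
   the bound [expd] on the remaining exponential. *)
exists (K / v * expR (m + eta) * (2 / eta)) => delta delta0 delta1.
have [_ _ mass0] := hdef _ delta0.
set M := gibbs_mass phi delta in mass0 *.
have massv : expR (- (m + eta / 2) / delta) * v <= M.
  by apply: (gibbs_mass_ge _ _ _ _ _ r0 delta0 hr); exact: iw.
set A := expR (- (m + eta) * (delta^-1 - 1)).
have centred : M * (gibbs_mean phi delta ord0 i - zstar ord0 i) = \int[mu]_z f delta z.
  rewrite /gibbs_mean /gibbs_moment !mxE mulrBr mulrA divff ?gt_eqF// mul1r.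
  rewrite [M * _]mulrC -RintegralZl//; last exact: iw.
  rewrite -RintegralB//; [|exact: izw|exact: icw].
  by apply: eq_Rintegral => z _; rewrite /f mulrBl.
(* The first term dominates the integrand inside the ball, the second outside; their sum dominates
   everywhere, so the domain need not be split. *)
have bound : `|\int[mu]_z f delta z| <= e * M + A * K.
  apply: (le_trans (le_normr_Rintegral _ (if_ _ delta0))) => //.
  have inf1 : mu.-integrable setT (EFin \o (fun z => `|f 1 z|)).
    by apply: integrable_norm; exact: if_.
  have iew : mu.-integrable setT (EFin \o (fun z => e * gibbs_weight phi delta z)).
    exact: (integrableZl measurableT e (iw _ delta0)).
  have iaf : mu.-integrable setT (EFin \o (fun z => A * `|f 1 z|)).
    exact: (integrableZl measurableT A inf1).
  rewrite -!RintegralZl//; last exact: iw.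
  rewrite -RintegralD//; apply: le_Rintegral => //.
  - by apply: integrable_norm; exact: if_.
  - exact: (integrableD measurableT iew iaf).
  move=> z _; have w0 := ltW (gibbs_weight_gt0 phi delta z).
  have w1 := ltW (gibbs_weight_gt0 phi 1 z).
  rewrite /f !normrM (ger0_norm w0) (ger0_norm w1).
  have [ez|ez] := leP e `|z - zstar|.
    apply: ler_wpDl; first by rewrite mulr_ge0// ltW.
    rewrite mulrCA ler_wpM2l//.
    by apply: gibbs_weight_le => //; exact: hgap.
  apply: ler_wpDr; first by rewrite !mulr_ge0// expR_ge0.
  rewrite ler_wpM2r// (le_trans _ (ltW ez))//.
  by have := coord_le_norm (z - zstar) i; rewrite !mxE.
have tail : A * K <= K / v * expR (m + eta) * (2 / eta) * delta * M.
  have expE : A = expR (m + eta) * expR (- (eta / 2 / delta)) * expR (- (m + eta / 2) / delta).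
    by rewrite -!expRD; congr expR; field; rewrite gt_eqF.
  (* Inverse of [x <= 1 + x <= expR x] at [x = eta / 2 / delta]. *)
  have expd : expR (- (eta / 2 / delta)) <= 2 / eta * delta.
    rewrite expRN -[leRHS]invrK lef_pV2 ?posrE ?expR_gt0 ?invr_gt0 ?mulr_gt0 ?invr_gt0//.
    rewrite !invfM invrK; apply: le_trans (expR_ge1Dx _).
    by rewrite [2^-1 * _]mulrC; apply: ler_wpDl.
  have -> : K / v * expR (m + eta) * (2 / eta) * delta * M =
      K * expR (m + eta) * (2 / eta * delta) * (M / v) by ring.
  have -> : A * K = K * expR (m + eta) * expR (- (eta / 2 / delta)) *
      expR (- (m + eta / 2) / delta) by rewrite expE; ring.
  apply: ler_pM; rewrite ?mulr_ge0 ?expR_ge0//; last by rewrite ler_pdivlMr.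
  by rewrite ler_wpM2l// mulr_ge0 ?expR_ge0.
rewrite distrC -(ler_pM2l mass0) -[X in X * `|_|]gtr0_norm// -normrM centred.
by apply: (le_trans bound); rewrite mulrDr [M * e]mulrC lerD2l [M * _]mulrC.
Qed.

End gibbs_mean.

(** * Convergence of the Gibbs means *)

Theorem theorem3 (R : realType) (d : nat) (phi : 'rV[R]_d.+1 -> R) (p : R)
    (zstar : 'rV[R]_d.+1) (p_gt0 : 0 < p)
    (phi_measurable : lebesgue_measurable phi)
    (phi_coercive : coercive p phi)
    (phi_min : unique_global_minimizer phi zstar)
    (phi_liminf : liminf_above_min phi zstar)
    (phi_cont : exists2 U : set 'rV[R]_d.+1,
       nbhs zstar U & {within U, continuous phi}) :
  (forall delta : R, 0 < delta -> gibbs_mean_defined phi delta) /\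
  gibbs_mean phi delta @[delta --> 0^'+] --> zstar.
Proof.
have hdef delta : 0 < delta -> gibbs_mean_defined phi delta.
  move=> delta0.
  have iw n (f : 'rV[R]_d.+1 -> R) : lebesgue_measurable f ->
      (forall z, `|f z| <= `|z| ^+ n) ->
      (lebesgue_Rn R d).-integrable setT
        (EFin \o (fun z => f z * gibbs_weight phi delta z)).
    exact: (integrable_gibbs_weight p phi zstar delta n f p_gt0 delta0 phi_coercive
      phi_min.1 phi_measurable).
  have iw0 : (lebesgue_Rn R d).-integrable setT (EFin \o gibbs_weight phi delta).
    have -> : gibbs_weight phi delta = fun z => 1 * gibbs_weight phi delta z.
      by apply/funext => z; rewrite mul1r.
    by apply: (iw 0%N) => [|z]; [exact: measurable_cst|rewrite expr0 normr1].
  split => //.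
    move=> i; apply: (iw 1%N); first exact: measurable_coord.
    by move=> z; exact: coord_le_norm.
  (* Any positive tolerance would do: an upper bound for [phi] on some cube makes the mass
     positive. *)
  have [r r0 hr] := continuous_le_on_cube phi zstar 1 ltr01 phi_cont.
  apply: lt_le_trans (gibbs_mass_ge phi zstar delta _ _ r0 delta0 hr iw0).
  by rewrite mulr_gt0 ?expR_gt0// exprn_gt0// mulr_gt0.
split => //; apply/cvgrPdist_le => e e0.
have e20 : 0 < e / 2 by rewrite divr_gt0.
have [C hC] := choice (fun i => gibbs_mean_coord_bound phi p zstar (e / 2) i p_gt0
  phi_coercive phi_min phi_liminf phi_cont hdef e20).
(* A positive bound for all the [C i] at once, so that one threshold on [delta] serves every
   coordinate. *)
pose D : R := 1 + \sum_i `|C i|.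
have D0 : 0 < D by rewrite ltr_pwDl// sumr_ge0.
near=> delta.
have delta0 : 0 < delta by near: delta; exact: nbhs_right_gt.
apply: norm_le_coord => [|i]; first exact: ltW.
have -> : (zstar - gibbs_mean phi delta) ord0 i = zstar ord0 i - gibbs_mean phi delta ord0 i.
  by rewrite !mxE.
apply: (le_trans (hC i delta delta0 _)).
  by near: delta; apply: nbhs_right_le.
have CD : C i <= D.
  apply: le_trans (ler_norm _) _; rewrite /D (bigD1 i)//= addrCA lerDl.
  by rewrite addr_ge0// sumr_ge0.
have : D * delta <= e / 2.
  rewrite mulrC -ler_pdivlMr//; near: delta.
  by apply: nbhs_right_le; rewrite divr_gt0.
by have := ler_wpM2r (ltW delta0) CD; lra.
Unshelve. all: by end_near. Qed.
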